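(* Consider the smart-meter system with no battery ($B_{\max}=0$), an i.i.d. input load with distribution $p_X$, and i.i.d. renewable energy with distribution $p_E$ whose realization is also known to the utility provider at each time. Let $\bar{\mathcal{I}}^i(0)=\inf_{f\in\mathcal F}\limsup_{n\to\infty}\frac1n I(X^n;Y^n\mid E^n)$ be the optimal information leakage rate. Then $$\bar{\mathcal{I}}^i(0)=\inf_{p_{Y|X,E}\in\mathcal P^i} I(X;Y\mid E)=\mathbb{E}_E\big[\mathcal{I}(E,E)\big],$$ where $\mathcal P^i=\{p_{Y|X,E}: p_{Y|X,E}(y|x,e)=0 \text{ if } y>x \text{ or } y<x-e\}$, $I(X;Y|E)$ is computed under $p_X(x)p_E(e)p_{Y|X,E}(y|x,e)$, and $\mathcal I(\cdot,\cdot)$ is the privacy-power function.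
   Context: Alphabets: $\mathcal X=\mathcal Y=\{0,1,\dots,X_{\max}\}$, $\mathcal E=\{0,1,\dots,E_{\max}\}$. The input load $(X_t)_{t\ge1}$ is i.i.d. with distribution $p_X$ on $\mathcal X$; the renewable energy $(E_t)_{t\ge 1}$ is i.i.d. with distribution $p_E$ on $\mathcal E$; the two sequences are independent. $X^n=(X_1,\dots,X_n)$, and similarly for the other sequences. $I$ denotes (conditional) mutual information. A (possibly randomized) causal energy management policy $f=(f_t)_{t\ge1}$ selects, at each time $t$, the output load $Y_t\in\mathcal Y$ according to a conditional distribution given $(X^t,E^t,Y^{t-1})$; the pairs $(X_s,E_s)$, $s>t$, are independent of everything up to and including time $t$. With no battery, the policy is feasible ($f\in\mathcal F$) if almost surely $0\le X_t-Y_t\le E_t$ for all $t$ (no further peak power constraint is imposed). Privacy-power function: for $\bar P,\hat P\ge0$, $\mathcal I(\bar P,\hat P)=\inf I(X;Y)$, where $X\sim p_X$ and the infimum is over conditional distributions $p_{Y|X}$ from $\mathcal X$ to $\mathcal Y$ with $\mathbb{E}[X-Y]\le\bar P$ and $0\le X-Y\le\hat P$ almost surely. *)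

(* Defs.v *)
From HB Require Import structures.
From mathcomp Require Import all_boot all_order all_algebra.
From mathcomp Require Import all_classical all_reals.
From mathcomp Require Import ereal sequences exp.

Set Implicit Arguments.
Unset Strict Implicit.
Unset Printing Implicit Defensive.

Import Order.TTheory GRing.Theory Num.Theory.

Local Open Scope classical_set_scope.
Local Open Scope ring_scope.

Record fdist (R : realType) (T : finType) := FDist {
  pmf :> T -> R;
  pmf_ge0 : forall x, 0 <= pmf x;
  pmf_sum1 : \sum_x pmf x = 1 }.

(** Throughout, [P] is a probability mass function on a finite sample space
    [W], and random variables are functions on [W]. *)

Definition Pr (R : realType) (W : finType) (P : W -> R) (A : pred W) : R :=
  \sum_(w | A w) P w.

Definition expect (R : realType) (W : finType) (P Z : W -> R) : R :=
  \sum_w P w * Z w.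

(** Information is measured in nats.  The convention 0 log 0 = 0 holds because
    every logarithm is multiplied by the probability of the event. *)

Definition mutual_info (R : realType) (W A B : finType) (P : W -> R)
    (U : W -> A) (V : W -> B) : R :=
  \sum_(a : A) \sum_(b : B)
    let p_ab := Pr P (fun w => (U w == a) && (V w == b)) in
    p_ab * ln (p_ab / (Pr P (fun w => U w == a) * Pr P (fun w => V w == b))).

Definition cond_mutual_info (R : realType) (W A B C : finType) (P : W -> R)
    (U : W -> A) (V : W -> B) (Z : W -> C) : R :=
  \sum_(a : A) \sum_(b : B) \sum_(c : C)
    let p_abc := Pr P (fun w => [&& U w == a, V w == b & Z w == c]) in
    p_abc * ln (Pr P (fun w => Z w == c) * p_abc /
                (Pr P (fun w => (U w == a) && (Z w == c)) *
                 Pr P (fun w => (V w == b) && (Z w == c)))).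

Notation load Xmax := 'I_Xmax.+1.
Notation energy Emax := 'I_Emax.+1.

(** The power [X - Y] supplied by the energy management unit, as a real number
    (natural-number subtraction would truncate it). *)
Definition saved (R : realType) (Xmax : nat) (x y : load Xmax) : R :=
  (x : nat)%:R - (y : nat)%:R.

(** [f t] is the conditional law of the output load at the [t]-th time step,
    counting from 0, so that it depends on [t.+1] input loads and energies and
    on [t] earlier output loads. *)
Definition policy (R : realType) (Xmax Emax : nat) : Type :=
  forall t : nat,
    {ffun 'I_t.+1 -> load Xmax} -> {ffun 'I_t.+1 -> energy Emax} ->
    {ffun 'I_t -> load Xmax} -> fdist R (load Xmax).

Definition upto (T : Type) (n : nat) (u : {ffun 'I_n -> T}) (t : 'I_n) :
    {ffun 'I_t.+1 -> T} :=
  [ffun i => u (widen_ord (ltn_ord t) i)].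

Definition before (T : Type) (n : nat) (u : {ffun 'I_n -> T}) (t : 'I_n) :
    {ffun 'I_t -> T} :=
  [ffun i => u (widen_ord (ltnW (ltn_ord t)) i)].

(** Sample space of the blocks [(X^n, E^n, Y^n)]. *)
Definition blocks (Xmax Emax n : nat) : finType :=
  ({ffun 'I_n -> load Xmax} * {ffun 'I_n -> energy Emax} *
   {ffun 'I_n -> load Xmax})%type.

Definition Xn (Xmax Emax n : nat) (w : blocks Xmax Emax n) := w.1.1.
Definition En (Xmax Emax n : nat) (w : blocks Xmax Emax n) := w.1.2.
Definition Yn (Xmax Emax n : nat) (w : blocks Xmax Emax n) := w.2.

Definition blocks_law (R : realType) (Xmax Emax : nat)
    (pX : fdist R (load Xmax)) (pE : fdist R (energy Emax))
    (f : policy R Xmax Emax) (n : nat) (w : blocks Xmax Emax n) : R :=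
  \prod_(t < n)
    (pX (Xn w t) * pE (En w t) *
     f t (upto (Xn w) t) (upto (En w) t) (before (Yn w) t) (Yn w t)).

(** Almost sure feasibility at all times amounts, by countable additivity, to
    almost sure feasibility over every finite horizon. *)
Definition feasible (R : realType) (Xmax Emax : nat)
    (pX : fdist R (load Xmax)) (pE : fdist R (energy Emax))
    (f : policy R Xmax Emax) : Prop :=
  forall n : nat,
    Pr (@blocks_law R Xmax Emax pX pE f n)
       (fun w => [forall t : 'I_n,
          0 <= saved R (Xn w t) (Yn w t) <= (En w t : nat)%:R]) = 1.

Definition leakage_rate (R : realType) (Xmax Emax : nat)
    (pX : fdist R (load Xmax)) (pE : fdist R (energy Emax))
    (f : policy R Xmax Emax) : \bar R :=
  limn_esup (fun n : nat =>
    (n%:R^-1 * cond_mutual_info (@blocks_law R Xmax Emax pX pE f n)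
                 (@Xn Xmax Emax n) (@Yn Xmax Emax n) (@En Xmax Emax n))%:E).

Definition optimal_leakage (R : realType) (Xmax Emax : nat)
    (pX : fdist R (load Xmax)) (pE : fdist R (energy Emax)) : \bar R :=
  ereal_inf [set leakage_rate pX pE f | f in [set f | feasible pX pE f]].

Definition kernel_class (R : realType) (Xmax Emax : nat)
    (k : load Xmax -> energy Emax -> fdist R (load Xmax)) : Prop :=
  forall (x : load Xmax) (e : energy Emax) (y : load Xmax),
    (x < y)%N || (y + e < x)%N -> k x e y = 0.

Definition single_letter_law (R : realType) (Xmax Emax : nat)
    (pX : fdist R (load Xmax)) (pE : fdist R (energy Emax))
    (k : load Xmax -> energy Emax -> fdist R (load Xmax))
    (w : load Xmax * energy Emax * load Xmax) : R :=
  pX w.1.1 * pE w.1.2 * k w.1.1 w.1.2 w.2.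

Definition single_letter_info (R : realType) (Xmax Emax : nat)
    (pX : fdist R (load Xmax)) (pE : fdist R (energy Emax))
    (k : load Xmax -> energy Emax -> fdist R (load Xmax)) : R :=
  cond_mutual_info (single_letter_law pX pE k)
    (fun w => w.1.1) (fun w => w.2) (fun w => w.1.2).

Definition channel_law (R : realType) (Xmax : nat)
    (pX : fdist R (load Xmax)) (k : load Xmax -> fdist R (load Xmax))
    (w : load Xmax * load Xmax) : R :=
  pX w.1 * k w.1 w.2.

(** Arguments: average power limit, then peak power limit. *)
Definition privacy_power (R : realType) (Xmax : nat)
    (pX : fdist R (load Xmax)) (Pavg Ppeak : R) : \bar R :=
  ereal_inf
    [set (mutual_info (channel_law pX k) (fun w => w.1) (fun w => w.2))%:E
    | k in [set k : load Xmax -> fdist R (load Xmax) |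
        expect (channel_law pX k) (fun w => saved R w.1 w.2) <= Pavg /\
        Pr (channel_law pX k)
           (fun w => 0 <= saved R w.1 w.2 <= Ppeak) = 1]].

(* Main.v *)
(** For a feasible policy let [Q(x,e,y) = P(y,e) \prod_t P(x_t | y_t,e_t)].
    Because the pairs [(X_t,E_t)] are independent,
    [I(X^n;Y^n|E^n) = \sum_t I(X_t;Y_t|E_t) + D(P||Q)], and [Q] has total mass at
    most 1.  Gibbs' inequality then bounds the leakage from below by single-letter
    terms, each of which is the information of a kernel of the feasible class;
    for a memoryless policy [P = Q], so the bound is attained.
    Since [X] and [E] are independent, [I(X;Y|E)] is the [p_E]-average of the
    informations of the channels [p(y|x,e)], which can be chosen separately for
    each [e]; the peak constraint [X - Y <= e] implies the average one. *)
Require Import Defs.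
From HB Require Import structures.
From mathcomp Require Import all_boot all_order all_algebra.
From mathcomp Require Import all_classical all_reals.
From mathcomp Require Import ereal sequences exp.
From mathcomp Require Import normedtype ring.

Set Implicit Arguments.
Unset Strict Implicit.
Unset Printing Implicit Defensive.

Import Order.TTheory GRing.Theory Num.Theory.

Local Open Scope classical_set_scope.
Local Open Scope ring_scope.

(** * Events, marginals and almost sure statements on a finite sample space *)

Section Probability.
Variables (R : realType) (W : finType) (P : W -> R).

Lemma eq_Pr (A B : pred W) : A =1 B -> Pr P A = Pr P B.
Proof. exact: eq_bigl. Qed.

Lemma Pr_pred1 (A : pred W) (w : W) : A =1 pred1 w -> Pr P A = P w.
Proof. by move=> Aw; rewrite /Pr (big_pred1 w). Qed.

Lemma Pr_total (T : finType) (U : W -> T) (A : pred W) :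
  Pr P A = \sum_a Pr P (fun w => A w && (U w == a)).
Proof. exact: (partition_big U xpredT). Qed.

(** Partitioning the sample space by the values of [U], [V] and [Z] turns the triple sum that
    defines [cond_mutual_info] into an expectation. Information identities can then be checked one
    sample point at a time, at points of positive mass. *)
Lemma sum_by_value (A B C : finType) (U : W -> A) (V : W -> B) (Z : W -> C)
    (F : A -> B -> C -> R) :
  \sum_a \sum_b \sum_c Pr P (fun w => [&& U w == a, V w == b & Z w == c]) * F a b c =
  \sum_w P w * F (U w) (V w) (Z w).
Proof.
rewrite [RHS](partition_big U xpredT)//; apply: eq_bigr => a _.
rewrite [RHS](partition_big V xpredT)//; apply: eq_bigr => b _.
rewrite [RHS](partition_big Z xpredT)//; apply: eq_bigr => c _.
rewrite /Pr big_distrl; apply: eq_big => [w|w /and3P[/eqP-> /eqP-> /eqP->]//].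
by rewrite andbA.
Qed.

Lemma Pr_map (W' : finType) (h : W -> W') (P' : W' -> R) (A : pred W') :
  (forall v, P' v = Pr P (fun w => h w == v)) ->
  Pr P' A = Pr P (fun w => A (h w)).
Proof.
move=> P'E; rewrite [RHS](partition_big h A)//=; apply: eq_bigr => v Av.
by rewrite P'E; apply: eq_bigl => w; case: eqP => [->|]; rewrite ?Av ?andbF.
Qed.

Hypothesis P_ge0 : forall w, 0 <= P w.

Lemma Pr_ge0 (A : pred W) : 0 <= Pr P A.
Proof. exact: sumr_ge0. Qed.

Lemma le_Pr (A B : pred W) : (forall w, A w -> B w) -> Pr P A <= Pr P B.
Proof.
move=> AB; rewrite /Pr [leRHS](bigID A)/= [X in _ <= X + _](_ : _ = Pr P A).
  by rewrite lerDl sumr_ge0.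
by apply: eq_bigl => w; apply: andb_idl => /AB.
Qed.

Lemma le_pmf_Pr (A : pred W) (w : W) : A w -> P w <= Pr P A.
Proof.
by move=> Aw; rewrite -(@Pr_pred1 (pred1 w) w)//; apply: le_Pr => v /eqP->.
Qed.

Lemma Pr_gt0 (A : pred W) (w : W) : A w -> 0 < P w -> 0 < Pr P A.
Proof. by move=> Aw Pw; exact: lt_le_trans Pw (le_pmf_Pr Aw). Qed.

Hypothesis P_sum1 : \sum_w P w = 1.

Lemma Pr_eq1 (A : pred W) : Pr P A = 1 <-> (forall w, ~~ A w -> P w = 0).
Proof.
have sumE : Pr P A + \sum_(w | ~~ A w) P w = 1 by rewrite -P_sum1 [RHS](bigID A).
split=> [PA1 w Aw|PA0]; last by rewrite -sumE [X in _ + X]big1 ?addr0.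
have : \sum_(w | ~~ A w) P w = 0.
  by apply: (addrI (Pr P A)); rewrite sumE PA1 addr0.
by move/psumr_eq0P; apply.
Qed.

End Probability.

(** * Gibbs' inequality and general properties of information *)

Section Information.
Variables (R : realType) (W : finType).
Implicit Types P Q : W -> R.

(** Apply ln z <= z - 1 at z = Q/P. Only the total masses are compared, so [Q] may be a
    subprobability, as [surrogate] is in general. *)
Lemma gibbs P Q :
  (forall w, 0 <= P w) -> (forall w, 0 <= Q w) ->
  (forall w, 0 < P w -> 0 < Q w) -> \sum_w Q w <= \sum_w P w ->
  0 <= \sum_w P w * ln (P w / Q w).
Proof.
move=> P0 Q0 PQ sQP.
apply: (@le_trans _ _ (\sum_w (P w - Q w))); first by rewrite sumrB subr_ge0.
apply: ler_sum => w _.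
have [Pw|Pw] := ltrP 0 (P w); last first.
  have -> : P w = 0 by apply/eqP; rewrite eq_le Pw P0.
  by rewrite mul0r sub0r oppr_le0.
have Qw := PQ _ Pw.
have : ln (Q w / P w) <= Q w / P w - 1.
  rewrite -{1}(subrKC 1 (Q w / P w)); apply: le_ln1Dx.
  by rewrite ltrBrDl subrr divr_gt0.
rewrite -[P w / Q w]invf_div lnV ?posrE ?divr_gt0// => /(ler_wpM2l (ltW Pw)) h.
rewrite mulrN lerNr opprB; apply: (le_trans h).
by rewrite mulrBr mulr1 mulrC divfK ?gt_eqF.
Qed.

Lemma cond_mutual_infoE P (A B C : finType) (U : W -> A) (V : W -> B) (Z : W -> C) :
  cond_mutual_info P U V Z = \sum_w P w *
    ln (Pr P (fun v => Z v == Z w) *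
        Pr P (fun v => [&& U v == U w, V v == V w & Z v == Z w]) /
        (Pr P (fun v => (U v == U w) && (Z v == Z w)) *
         Pr P (fun v => (V v == V w) && (Z v == Z w)))).
Proof.
exact: (sum_by_value P U V Z (fun a b c =>
  ln (Pr P (fun v => Z v == c) *
      Pr P (fun v => [&& U v == a, V v == b & Z v == c]) /
      (Pr P (fun v => (U v == a) && (Z v == c)) *
       Pr P (fun v => (V v == b) && (Z v == c)))))).
Qed.

(** Information depends only on the joint law of the three variables. This is what moves it between
    block laws and single-letter laws. *)
Lemma cond_mutual_info_map P (W' A B C : finType) (h : W -> W') (P' : W' -> R)
    (U : W' -> A) (V : W' -> B) (Z : W' -> C) :
  (forall v, P' v = Pr P (fun w => h w == v)) ->
  cond_mutual_info P' U V Z = cond_mutual_info P (U \o h) (V \o h) (Z \o h).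
Proof.
move=> P'E; rewrite /cond_mutual_info.
apply: eq_bigr => a _; apply: eq_bigr => b _; apply: eq_bigr => c _.
by rewrite !(Pr_map _ P'E).
Qed.

End Information.

(** Gibbs' inequality for the joint law against the product of its marginals. *)
Lemma mutual_info_ge0 (R : realType) (A B : finType) (P : A * B -> R) :
  (forall w, 0 <= P w) -> \sum_w P w = 1 ->
  0 <= mutual_info P (fun w => w.1) (fun w => w.2).
Proof.
move=> P0 P1; rewrite /mutual_info pair_bigA/=.
rewrite (eq_bigr (fun w => P w * ln (P w / (Pr P (fun v => v.1 == w.1) *
   Pr P (fun v => v.2 == w.2))))); last first.
  by move=> w _; rewrite (@Pr_pred1 _ _ _ _ w)// => -[a b]; case: w.
apply: gibbs => // [w|w Pw|].
- by rewrite mulr_ge0 ?Pr_ge0.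
- by rewrite mulr_gt0 ?(Pr_gt0 P0 _ Pw).
rewrite -(pair_bigA _ (fun a b => Pr P (fun v => v.1 == a) * Pr P (fun v => v.2 == b)))/=.
rewrite -big_distrlr/= P1.
rewrite -(Pr_total P (fun w => w.1) xpredT) -(Pr_total P (fun w => w.2) xpredT).
by rewrite /Pr P1 mulr1.
Qed.

(** * Sums of product laws over blocks *)

Lemma ln_prod (R : realType) (I : Type) (r : seq I) (F : I -> R) :
  (forall i, 0 < F i) -> ln (\prod_(i <- r) F i) = \sum_(i <- r) ln (F i).
Proof.
move=> F0; elim: r => [|i r IH]; first by rewrite !big_nil ln1.
by rewrite !big_cons lnM ?posrE ?prodr_gt0// IH.
Qed.

Lemma sum_prod_at (R : realType) (n : nat) (T : finType) (p : T -> R) (t : 'I_n) (a : T) :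
  \sum_b p b = 1 -> \sum_(u : {ffun 'I_n -> T} | u t == a) \prod_s p (u s) = p a.
Proof.
(* Zeroing the [t]-th factor away from [a] absorbs the constraint [u t == a]. The sum then runs over
   all functions and distributes over the product. *)
move=> p1; pose q s b := if (s == t) && (b != a) then 0 else p b.
rewrite big_mkcond (eq_bigr (fun u : {ffun 'I_n -> T} => \prod_s q s (u s))); last first.
  move=> u _; case: ifPn => uta; last by rewrite (bigD1 t)//= /q eqxx uta/= mul0r.
  by apply: eq_bigr => s _; rewrite /q; case: eqP => // ->; rewrite uta.
rewrite -bigA_distr_bigA (bigD1 t)//= [X in _ * X]big1 => [|s st]; last first.
  by rewrite -[RHS]p1; apply: eq_bigr => b _; rewrite /q (negPf st).
rewrite mulr1 (bigD1 a)//= big1 => [|b ba]; last by rewrite /q eqxx ba.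
by rewrite /q !eqxx addr0.
Qed.

(** Sum out the last letter first: no earlier factor depends on it, and its own factor sums to 1
    given the past. Induction on [n] handles the rest. *)
Lemma sum_causal_prod (R : realType) (T : finType) (n : nat)
    (g : forall t : 'I_n, {ffun 'I_t -> T} -> T -> R) :
  (forall t u, \sum_a g t u a = 1) ->
  \sum_(y : {ffun 'I_n -> T}) \prod_t g t (before y t) (y t) = 1.
Proof.
elim: n g => [|n IH] g g1.
  under eq_bigr do rewrite big_ord0.
  by rewrite sumr_const card_ffun card_ord expn0.
(* Appending a last letter is a bijection from pairs (past, letter) onto blocks of length [n.+1]. *)
pose snoc (p : {ffun 'I_n -> T} * T) : {ffun 'I_n.+1 -> T} :=
  [ffun i => oapp p.1 p.2 (unlift ord_max i)].
have snocE p (i : 'I_n.+1) (j : 'I_n) : i = j :> nat -> snoc p i = p.1 j.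
  move=> ij; have -> : i = lift ord_max j by apply: ord_inj; rewrite lift_max.
  by rewrite ffunE liftK.
have snoc_max p : snoc p ord_max = p.2 by rewrite ffunE unlift_none.
have before_max p : before (snoc p) ord_max = p.1.
  by apply/ffunP => i; rewrite ffunE; exact: snocE.
rewrite (reindex snoc); last first.
  exists (fun y => (before y ord_max : {ffun 'I_n -> T}, y ord_max)) => [[u a] _|y _].
    by rewrite before_max snoc_max.
  apply/ffunP => i; rewrite ffunE; case: unliftP => [j ->|->]//=.
  by rewrite ffunE; congr (y _); apply: ord_inj; rewrite lift_max.
pose g' (t : 'I_n) := g (widen_ord (leqnSn n) t).
rewrite -[RHS](IH g')//; last by move=> t u; apply: g1.
rewrite -(pair_bigA _ (fun u a => \prod_t g t (before (snoc (u, a)) t) (snoc (u, a) t)))/=.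
apply: eq_bigr => u _.
rewrite -[RHS]mulr1 -[X in _ = _ * X](g1 ord_max u) big_distrr; apply: eq_bigr => a _ /=.
rewrite big_ord_recr/= before_max snoc_max; congr (_ * _).
apply: eq_bigr => t _; rewrite /g' (@snocE _ _ t)//; congr (g _ _ _).
by apply/ffunP => i; rewrite ffunE [RHS]ffunE; exact: (snocE (u, a)).
Qed.

(** * Splitting block information into single-letter terms and a divergence *)

Section Blocks.
Variables (R : realType) (A B C : finType) (n : nat).
Let W : finType := ({ffun 'I_n -> A} * {ffun 'I_n -> C} * {ffun 'I_n -> B})%type.
Variable P : W -> R.
Hypothesis P_ge0 : forall w, 0 <= P w.

(* The law [Q] of the header, with conditional probabilities [0/0 = 0]. *)
Definition surrogate (w : W) : R :=
  Pr P (fun v => (v.2 == w.2) && (v.1.2 == w.1.2)) *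
  \prod_t (Pr P (fun v => [&& v.1.1 t == w.1.1 t, v.2 t == w.2 t & v.1.2 t == w.1.2 t]) /
           Pr P (fun v => (v.2 t == w.2 t) && (v.1.2 t == w.1.2 t))).

Lemma surrogate_ge0 w : 0 <= surrogate w.
Proof. by rewrite mulr_ge0 ?prodr_ge0 ?Pr_ge0// => t _; rewrite divr_ge0 ?Pr_ge0. Qed.

Lemma surrogate_gt0 w : 0 < P w -> 0 < surrogate w.
Proof.
move=> Pw; rewrite mulr_gt0 ?prodr_gt0 ?(Pr_gt0 P_ge0 _ Pw) ?eqxx// => t _.
by rewrite divr_gt0 ?(Pr_gt0 P_ge0 _ Pw) ?eqxx.
Qed.

(** For fixed [e] and [y], the sum over [x] of the product is the product over [t] of the sums
    [\sum_a r t a (y t) (e t)]. Each of these is 1, or 0 when the conditioning event is null, so at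
    most the mass of [(y, e)] remains. *)
Lemma sum_surrogate : \sum_w surrogate w <= \sum_w P w.
Proof.
pose S (e : {ffun 'I_n -> C}) (y : {ffun 'I_n -> B}) :=
  Pr P (fun v => (v.2 == y) && (v.1.2 == e)).
pose m t a b c := Pr P (fun v => [&& v.1.1 t == a, v.2 t == b & v.1.2 t == c]).
pose d t b c := Pr P (fun v => (v.2 t == b) && (v.1.2 t == c)).
pose r t a b c := m t a b c / d t b c.
have sum_r t b c : 0 <= \sum_a r t a b c <= 1.
  rewrite sumr_ge0 => [|a _]; last by rewrite divr_ge0 ?Pr_ge0.
  rewrite -big_distrl/= (_ : \sum_a _ = d t b c); last first.
    rewrite /d (Pr_total P (fun w => w.1.1 t)); apply: eq_bigr => a _.
    by apply: eq_Pr => w; rewrite andbC.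
  have [->|d0] := eqVneq (d t b c) 0; first by rewrite mul0r ler01.
  by rewrite divff ?lexx.
rewrite -(pair_bigA _ (fun xe y => surrogate (xe, y)))/=.
rewrite -(pair_bigA _ (fun x e => \sum_y surrogate ((x, e), y)))/= exchange_big/=.
have -> : \sum_w P w = \sum_e \sum_y S e y.
  rewrite -[LHS]/(Pr P xpredT) (Pr_total P (fun w => w.1.2)); apply: eq_bigr => e _.
  by rewrite (Pr_total P (fun w => w.2)); apply: eq_bigr => y _; apply: eq_Pr => w; rewrite andbC.
apply: ler_sum => e _; rewrite exchange_big; apply: ler_sum => y _.
rewrite /surrogate/= -big_distrr/= -[leRHS]mulr1; apply: ler_wpM2l; first exact: Pr_ge0.
rewrite -(bigA_distr_bigA (fun t a => r t a (y t) (e t))).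
by rewrite prodr_ile1.
Qed.

(** The hypothesis is independence of the pairs (X_t, E_t) across time. It makes P(x,e) and P(e)
    products over [t]. At each point of positive mass the two sides then have the same logarithm, by
    cancelling fractions. *)
Lemma cond_mutual_info_blocks :
  (forall x e, Pr P (fun w => (w.1.1 == x) && (w.1.2 == e)) =
     \prod_t Pr P (fun w => (w.1.1 t == x t) && (w.1.2 t == e t))) ->
  cond_mutual_info P (fun w => w.1.1) (fun w => w.2) (fun w => w.1.2) =
  \sum_t cond_mutual_info P (fun w => w.1.1 t) (fun w => w.2 t) (fun w => w.1.2 t) +
  \sum_w P w * ln (P w / surrogate w).
Proof.
move=> PXE.
have PE e : Pr P (fun w => w.1.2 == e) = \prod_t Pr P (fun w => w.1.2 t == e t).
  rewrite (Pr_total P (fun w => w.1.1)).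
  transitivity (\sum_(x : {ffun 'I_n -> A}) \prod_t Pr P (fun w => (w.1.1 t == x t) && (w.1.2 t == e t))).
    by apply: eq_bigr => x _; rewrite -PXE; apply: eq_Pr => w; rewrite andbC.
  rewrite -(bigA_distr_bigA (fun t a => Pr P (fun w => (w.1.1 t == a) && (w.1.2 t == e t)))).
  apply: eq_bigr => t _; rewrite (Pr_total P (fun w => w.1.1 t)).
  by apply: eq_bigr => a _; apply: eq_Pr => w; rewrite andbC.
rewrite cond_mutual_infoE; under [X in _ = X + _]eq_bigr do rewrite cond_mutual_infoE.
rewrite exchange_big -big_split/=; apply: eq_bigr => w _.
rewrite -big_distrr -mulrDr/=.
have [Pw|] := ltrP 0 (P w); last first.
  by move=> Pw; rewrite (_ : P w = 0) ?mul0r//; apply/eqP; rewrite eq_le Pw P_ge0.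
have pos (D : pred W) : D w -> 0 < Pr P D by move=> /(Pr_gt0 P_ge0); apply.
congr (_ * _); rewrite -ln_prod => [|t]; last first.
  by rewrite divr_gt0 ?mulr_gt0 ?pos ?eqxx.
rewrite -lnM ?posrE ?divr_gt0 ?surrogate_gt0 ?prodr_gt0// => [|t _]; last first.
  by rewrite divr_gt0 ?mulr_gt0 ?pos ?eqxx.
congr ln; rewrite PE PXE (@Pr_pred1 _ _ _ _ w); last first.
  by case: w {Pw pos} => [[x e] y] [[x' e'] y']; rewrite /= -!pair_eqE /pair_eq/= andbAC -andbA.
rewrite /surrogate !prodf_div !big_split/=.
set c := \prod_t _; set d := \prod_t _; set s := Pr P _.
set m := \prod_t _; set k := \prod_t _.
have [d0 s0 m0 k0] : [/\ d != 0, s != 0, m != 0 & k != 0].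
  by split; rewrite gt_eqF ?prodr_gt0 ?pos ?eqxx// => t _; rewrite pos ?eqxx.
by field; rewrite d0 s0 m0 k0.
Qed.

End Blocks.

Lemma savedE (R : realType) (Xmax : nat) (x y : load Xmax) (e : nat) :
  (0 <= saved R x y <= e%:R) = ~~ ((x < y)%N || (y + e < x)%N).
Proof. by rewrite /saved subr_ge0 lerBlDl -natrD !ler_nat negb_or -!leqNgt. Qed.

(** The conditional law is [m b / s]. When [s] is zero it is undefined, and the point mass at [x0]
    replaces it; as [x0] lies in [D], the support constraint holds even under a null condition. *)
Lemma exists_conditional (R : realType) (T : finType) (s : R) (m : T -> R)
    (D : pred T) (x0 : T) :
  (forall b, 0 <= m b) -> \sum_b m b = s ->
  D x0 -> (forall b, ~~ D b -> m b = 0) ->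
  exists p : fdist R T, (forall b, s * p b = m b) /\ (forall b, ~~ D b -> p b = 0).
Proof.
move=> m0 ms Dx0 mD; have s0 : 0 <= s by rewrite -ms sumr_ge0.
have [sE|sN0] := eqVneq s 0.
  have p0 b : 0 <= ((b == x0)%:R : R) by rewrite ler0n.
  have p1 : \sum_b ((b == x0)%:R : R) = 1.
    by rewrite (bigD1 x0)//= eqxx big1 ?addr0// => b /negPf->.
  exists (FDist p0 p1); split=> [b|b /= Db]; last by case: eqP Db => // ->; rewrite Dx0.
  rewrite sE mul0r; apply/esym; move: b (erefl true).
  by move: ms; rewrite sE => /psumr_eq0P; apply.
have p0 b : 0 <= m b / s by rewrite divr_ge0.
have p1 : \sum_b m b / s = 1 by rewrite -big_distrl/= ms divff.
exists (FDist p0 p1); split=> [b|b /mD /= ->]; last by rewrite mul0r.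
by rewrite /= mulrC divfK.
Qed.

(** * Single-letter information and the privacy-power function *)

Section SingleLetter.
Variables (R : realType) (Xmax Emax : nat).
Variables (pX : fdist R (load Xmax)) (pE : fdist R (energy Emax)).
Implicit Types (k : load Xmax -> energy Emax -> fdist R (load Xmax))
  (q : load Xmax -> fdist R (load Xmax)).

Lemma channel_law_ge0 q w : 0 <= channel_law pX q w.
Proof. by rewrite mulr_ge0 ?pmf_ge0. Qed.

Lemma sum_channel_law q : \sum_w channel_law pX q w = 1.
Proof.
rewrite -(pair_bigA _ (fun x y => channel_law pX q (x, y)))/= -(pmf_sum1 pX).
by apply: eq_bigr => x _; rewrite /channel_law/= -big_distrr/= pmf_sum1 mulr1.
Qed.

(** Since X and E are independent, every probability involving the energy value [c] carries a factor
    [pE c]. These factors cancel inside the logarithm and leave one outside as the weight. *)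
Lemma single_letter_infoE k :
  single_letter_info pX pE k = \sum_c pE c *
    mutual_info (channel_law pX (k^~ c)) (fun w => w.1) (fun w => w.2).
Proof.
set L := single_letter_law pX pE k.
have LE a b c : Pr L (fun w => [&& w.1.1 == a, w.2 == b & w.1.2 == c]) =
    pE c * (pX a * k a c b).
  rewrite (@Pr_pred1 _ _ _ _ (a, c, b)) => [|[[x e] y]]; last first.
    by rewrite /= -!pair_eqE /pair_eq/= andbAC -andbA.
  by rewrite /L /single_letter_law/= mulrCA mulrA.
have LXZ a c : Pr L (fun w => (w.1.1 == a) && (w.1.2 == c)) = pE c * pX a.
  rewrite (Pr_total L (fun w => w.2)).
  rewrite (eq_bigr (fun b => pE c * (pX a * k a c b))) => [|b _]; last first.
    by rewrite -LE; apply: eq_Pr => w; rewrite -andbA [(_ == c) && _]andbC.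
  by rewrite -!big_distrr/= pmf_sum1 mulr1.
have LZ c : Pr L (fun w => w.1.2 == c) = pE c.
  rewrite (Pr_total L (fun w => w.1.1)).
  rewrite (eq_bigr (fun a => pE c * pX a)) => [|a _]; last first.
    by rewrite -LXZ; apply: eq_Pr => w; rewrite andbC.
  by rewrite -!big_distrr/= pmf_sum1 mulr1.
have KE q a b : Pr (channel_law pX q) (fun w => (w.1 == a) && (w.2 == b)) = pX a * q a b.
  by rewrite (@Pr_pred1 _ _ _ _ (a, b)).
have KX q a : Pr (channel_law pX q) (fun w => w.1 == a) = pX a.
  rewrite (Pr_total _ (fun w => w.2)) -[RHS]mulr1 -(pmf_sum1 (q a)) big_distrr.
  by apply: eq_bigr => b _; rewrite KE.
have LYZ b c : Pr L (fun w => (w.2 == b) && (w.1.2 == c)) =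
    pE c * Pr (channel_law pX (k^~ c)) (fun w => w.2 == b).
  rewrite (Pr_total L (fun w => w.1.1)) (Pr_total (channel_law _ _) (fun w => w.1)).
  rewrite big_distrr; apply: eq_bigr => a _ /=.
  rewrite (_ : Pr L _ = pE c * (pX a * k a c b)); last first.
    by rewrite -LE; apply: eq_Pr => w; rewrite andbC.
  by rewrite -(KE (k^~ c)); congr (_ * _); apply: eq_Pr => w; rewrite andbC.
rewrite /single_letter_info /cond_mutual_info -/L.
under eq_bigr do rewrite exchange_big.
rewrite exchange_big/=; apply: eq_bigr => c _.
rewrite /mutual_info big_distrr; apply: eq_bigr => a _ /=.
rewrite big_distrr; apply: eq_bigr => b _ /=.
rewrite LE LXZ LZ LYZ KE KX -mulrA.
have [->|c0] := eqVneq (pE c) 0; first by rewrite !mul0r.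
congr (_ * (_ * ln _)).
by rewrite mulrACA [X in X / _]mulrA -mulf_div divff ?mul1r// mulf_neq0.
Qed.

Lemma privacy_powerE (e : nat) :
  privacy_power pX e%:R e%:R = ereal_inf
    [set (mutual_info (channel_law pX q) (fun w => w.1) (fun w => w.2))%:E
    | q in [set q : load Xmax -> fdist R (load Xmax) |
        forall x y : load Xmax, (x < y)%N || (y + e < x)%N -> q x y = 0]].
Proof.
rewrite /privacy_power; congr ereal_inf; apply/seteqP; split=> _ [q qP <-].
- have [_] := qP.
  move/(Pr_eq1 (channel_law_ge0 q) (sum_channel_law q)) => q0.
  (* The almost sure constraint says nothing about rows with [pX x = 0]. Those rows are replaced by
     the point mass y = x, which leaves [channel_law] unchanged. *)
  have /choice[q' q'P] : forall x, exists p : fdist R (load Xmax),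
      (forall y, pX x * p y = pX x * q x y) /\
      (forall y : load Xmax, ~~ ~~ ((x < y)%N || (y + e < x)%N) -> p y = 0).
    move=> x; apply: (@exists_conditional _ _ _ _ _ x) => [y|||y xy].
    + by rewrite mulr_ge0 ?pmf_ge0.
    + by rewrite -big_distrr/= pmf_sum1 mulr1.
    + by rewrite ltnn/= -leqNgt leq_addr.
    + by apply: (q0 (x, y)); rewrite savedE.
  exists q' => [x y xy|]; first by have [_] := q'P x; apply; rewrite negbK.
  rewrite (_ : channel_law pX q' = channel_law pX q)//.
  by apply/funext => w; have [qw _] := q'P w.1; exact: qw.
- exists q => //; split.
    (* The average constraint follows from the peak one: pairs where the saved power exceeds [e]
       have mass zero. *)
    rewrite -[leRHS]mul1r -[X in _ <= X * _](sum_channel_law q) big_distrl/=.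
    apply: ler_sum => w _; have [|] := boolP (0 <= saved R w.1 w.2 <= e%:R).
      by case/andP=> _ ?; rewrite ler_wpM2l ?channel_law_ge0.
    by rewrite savedE negbK /channel_law => /qP->; rewrite mulr0 !mul0r.
  apply/(Pr_eq1 (channel_law_ge0 q) (sum_channel_law q)) => w.
  by rewrite savedE negbK /channel_law => /qP->; rewrite mulr0.
Qed.

End SingleLetter.

(** The objective is separable, so each [k i] can be chosen within [eps] of its own infimum. As the
    weights sum to 1, the total error is [eps]. Nonnegativity of [M] and nonemptiness of each [D i]
    make the infima finite. *)
Lemma ereal_inf_convex_comb (R : realType) (I : finType) (K : Type) (p : fdist R I)
    (D : I -> set K) (M : K -> R) :
  (forall x, 0 <= M x) -> (forall i, D i !=set0) ->
  ereal_inf [set (\sum_i p i * M (k i))%:E | k in [set k : I -> K | forall i, D i (k i)]] =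
  (\sum_i (p i)%:E * ereal_inf [set (M x)%:E | x in D i])%E.
Proof.
move=> M0 D0; apply/eqP; rewrite eq_le; apply/andP; split; last first.
  apply/ereal_infP => _ [k Dk <-]; rewrite -sumEFin; apply: lee_sum => i _.
  rewrite EFinM; apply: lee_wpmul2l; first by rewrite lee_fin pmf_ge0.
  by apply: ereal_inf_lbound; exists (k i).
have inf_fin i : ereal_inf [set (M x)%:E | x in D i] \is a fin_num.
  have [x Dx] := D0 i; rewrite ge0_fin_numE.
    by apply: (@le_lt_trans _ _ (M x)%:E); [apply: ereal_inf_lbound; exists x|exact: ltry].
  by apply/ereal_infP => _ [y _ <-]; rewrite lee_fin.
apply/lee_addgt0Pr => eps eps0.
have /choice[k kP] : forall i, exists x, D i x /\
    ((M x)%:E <= ereal_inf [set (M x)%:E | x in D i] + eps%:E)%E.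
  move=> i; have [_ [x Dx <-] /ltW] := lb_ereal_inf_adherent eps0 (inf_fin i).
  by exists x.
apply: (@le_trans _ _ (\sum_i p i * M (k i))%:E).
  by apply: ereal_inf_lbound; exists k => // i; have [] := kP i.
have -> : eps%:E = (\sum_i (p i)%:E * eps%:E)%E.
  under eq_bigr do rewrite -EFinM.
  by rewrite sumEFin -big_distrl/= pmf_sum1 mul1r.
rewrite -sumEFin -big_split/=; apply: lee_sum => i _.
rewrite EFinM -muleDr//; last by rewrite fin_num_adde_defl.
by apply: lee_wpmul2l; [rewrite lee_fin pmf_ge0|have [] := kP i].
Qed.

(** * Lower bound on the leakage of a feasible policy *)

Section BlocksLaw.
Variables (R : realType) (Xmax Emax : nat).
Variables (pX : fdist R (load Xmax)) (pE : fdist R (energy Emax)).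
Variables (f : policy R Xmax Emax) (n : nat).

Notation law := (@blocks_law R Xmax Emax pX pE f n).

Lemma blocks_law_ge0 w : 0 <= law w.
Proof. by apply: prodr_ge0 => t _; rewrite !mulr_ge0 ?pmf_ge0. Qed.

(** The policy factors form a causal product in [y], which sums to 1 for any fixed inputs. Loads and
    energies thus keep their i.i.d. law under every policy. *)
Lemma blocks_law_XE (x : {ffun 'I_n -> load Xmax}) (e : {ffun 'I_n -> energy Emax}) :
  Pr law (fun w => (w.1.1 == x) && (w.1.2 == e)) = \prod_t (pX (x t) * pE (e t)).
Proof.
pose g (t : 'I_n) u y := f (upto x t) (upto e t) u y.
rewrite -[RHS]mulr1 -[X in _ = _ * X](sum_causal_prod (g := g)); last first.
  by move=> t u; exact: pmf_sum1.
rewrite (Pr_total _ (fun w => w.2)) big_distrr; apply: eq_bigr => y _ /=.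
rewrite (@Pr_pred1 _ _ _ _ (x, e, y)) => [|[[x' e'] y']//].
by rewrite -big_split.
Qed.

Lemma sum_blocks_law : \sum_w law w = 1.
Proof.
rewrite -[LHS]/(Pr law xpredT) (Pr_total _ (fun w => w.1)).
rewrite (eq_bigr (fun xe : {ffun 'I_n -> load Xmax} * {ffun 'I_n -> energy Emax} =>
  (\prod_t pX (xe.1 t)) * \prod_t pE (xe.2 t))) => [|[x e] _]; last first.
  by rewrite -big_split -blocks_law_XE; apply: eq_Pr.
rewrite -(pair_bigA _ (fun x e : {ffun _ -> _} => (\prod_t pX (x t)) * \prod_t pE (e t)))/=.
rewrite -big_distrlr/= -(bigA_distr_bigA (fun=> pX)) -(bigA_distr_bigA (fun=> pE)).
by rewrite !pmf_sum1 !big1 ?mulr1.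
Qed.

Lemma blocks_law_XE_at (t : 'I_n) (a : load Xmax) (c : energy Emax) :
  Pr law (fun w => (w.1.1 t == a) && (w.1.2 t == c)) = pX a * pE c.
Proof.
rewrite (Pr_total _ (fun w => w.1)).
(* Both marginals are expanded into sums over blocks whose [t]-th letter is fixed, to be compared
   term by term. *)
rewrite -(sum_prod_at t a (pmf_sum1 pX)) -(sum_prod_at t c (pmf_sum1 pE)).
rewrite big_distrlr/= pair_big/= [RHS]big_mkcond/=; apply: eq_bigr => -[x e] _ /=.
case: ifPn => xe.
  rewrite -big_split -blocks_law_XE; apply: eq_Pr => -[[x' e'] y'] /=.
  by rewrite xpair_eqE; apply: andb_idl => /andP[/eqP-> /eqP->].
rewrite /Pr big_pred0// => -[[x' e'] y'] /=; rewrite xpair_eqE.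
by apply: contraNF xe => /andP[+ /andP[/eqP<- /eqP<-]].
Qed.

Lemma cond_mutual_info_blocks_law :
  cond_mutual_info law (@Xn Xmax Emax n) (@Yn Xmax Emax n) (@En Xmax Emax n) =
  \sum_t cond_mutual_info law (fun w => w.1.1 t) (fun w => w.2 t) (fun w => w.1.2 t) +
  \sum_w law w * ln (law w / surrogate law w).
Proof.
apply: (cond_mutual_info_blocks blocks_law_ge0) => x e.
by rewrite blocks_law_XE; apply: eq_bigr => t _; rewrite blocks_law_XE_at.
Qed.

Lemma sum_letter_info_le :
  \sum_t cond_mutual_info law (fun w => w.1.1 t) (fun w => w.2 t) (fun w => w.1.2 t) <=
  cond_mutual_info law (@Xn Xmax Emax n) (@Yn Xmax Emax n) (@En Xmax Emax n).
Proof.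
rewrite cond_mutual_info_blocks_law lerDl; apply: gibbs => [w|w|w|].
- exact: blocks_law_ge0.
- exact: (surrogate_ge0 blocks_law_ge0).
- exact: (surrogate_gt0 blocks_law_ge0).
- exact: (sum_surrogate blocks_law_ge0).
Qed.

(** The kernel is the conditional law of Y_t given (X_t, E_t). Feasibility bounds its support where
    the pair has positive probability; elsewhere it is the point mass y = x, which is always
    allowed. *)
Lemma exists_letter_kernel (t : 'I_n) : feasible pX pE f ->
  exists2 k, kernel_class k & single_letter_info pX pE k =
    cond_mutual_info law (fun w => w.1.1 t) (fun w => w.2 t) (fun w => w.1.2 t).
Proof.
move=> /(_ n)/(Pr_eq1 blocks_law_ge0 sum_blocks_law) f0.
pose m a c b := Pr law (fun w => (w.1.1 t, w.1.2 t, w.2 t) == (a, c, b)).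
have /choice[k kP] : forall ac : load Xmax * energy Emax, exists p : fdist R (load Xmax),
    (forall b, pX ac.1 * pE ac.2 * p b = m ac.1 ac.2 b) /\
    (forall b : load Xmax, ~~ ~~ ((ac.1 < b)%N || (b + ac.2 < ac.1)%N) -> p b = 0).
  move=> [a c]; apply: (@exists_conditional _ _ _ _ _ a) => [b|||b /=].
  - exact: Pr_ge0 blocks_law_ge0 _.
  - rewrite /= -(blocks_law_XE_at t) (Pr_total _ (fun w : blocks Xmax Emax n => w.2 t)).
    by apply: eq_bigr => b _; apply: eq_Pr => w; rewrite !xpair_eqE.
  - by rewrite ltnn/= -leqNgt leq_addr.
  - rewrite negbK => abc; rewrite /m /Pr big1// => w /eqP[wa wc wb].
    apply: f0; rewrite negb_forall; apply/existsP; exists t.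
    by rewrite savedE negbK /Xn /Yn /En wa wb wc.
exists (fun a c => k (a, c)) => [x e y xy|].
  by have [_] := kP (x, e); apply; rewrite negbK.
apply: (@cond_mutual_info_map _ _ law _ _ _ _ (fun w : blocks Xmax Emax n =>
  (w.1.1 t, w.1.2 t, w.2 t))).
by move=> [[a c] b]; have [pk _] := kP (a, c); exact: pk.
Qed.

End BlocksLaw.

(** * Memoryless policies attain the single-letter information *)

Section Memoryless.
Variables (R : realType) (Xmax Emax : nat).
Variables (pX : fdist R (load Xmax)) (pE : fdist R (energy Emax)).
Variable k : load Xmax -> energy Emax -> fdist R (load Xmax).

(** Here [ord_max] indexes the current time, the last of the [t.+1] known inputs. *)
Definition memoryless : policy R Xmax Emax :=
  fun t x e y => k (x ord_max) (e ord_max).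

Notation law n := (@blocks_law R Xmax Emax pX pE memoryless n).

Lemma memoryless_lawE n (w : blocks Xmax Emax n) :
  law n w = \prod_t single_letter_law pX pE k (w.1.1 t, w.1.2 t, w.2 t).
Proof.
apply: eq_bigr => t _; rewrite /memoryless !ffunE /single_letter_law/=.
have -> : widen_ord (ltn_ord t) ord_max = t by exact: val_inj.
by [].
Qed.

Lemma memoryless_feasible : kernel_class k -> feasible pX pE memoryless.
Proof.
move=> k0 n; apply/(Pr_eq1 (@blocks_law_ge0 _ _ _ pX pE _ n) (sum_blocks_law pX pE _ n)) => w.
rewrite negb_forall => /existsP[t]; rewrite savedE negbK => /k0 kt.
by rewrite memoryless_lawE (bigD1 t)//= /single_letter_law/= kt mulr0 mul0r.
Qed.

Lemma memoryless_letter n (t : 'I_n) v :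
  single_letter_law pX pE k v =
  Pr (law n) (fun w => (w.1.1 t, w.1.2 t, w.2 t) == v).
Proof.
pose T : finType := (load Xmax * energy Emax * load Xmax)%type.
have q1 : \sum_w single_letter_law pX pE k w = 1.
  rewrite -(pair_bigA _ (fun xe y => single_letter_law pX pE k (xe, y)))/=.
  rewrite -(pair_bigA _ (fun x e => \sum_y single_letter_law pX pE k (x, e, y)))/=.
  rewrite -[RHS](pmf_sum1 pX); apply: eq_bigr => x _.
  rewrite -[RHS]mulr1 -[X in _ * X](pmf_sum1 pE) big_distrr; apply: eq_bigr => e _.
  by rewrite /single_letter_law/= -big_distrr/= pmf_sum1 mulr1.
rewrite -(sum_prod_at t v q1) /Pr.
(* Regrouping a triple of blocks as a block of triples makes the law i.i.d. over triples, so
   [sum_prod_at] gives its marginal at [t]. *)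
pose zip (w : blocks Xmax Emax n) : {ffun 'I_n -> T} :=
  [ffun s => (w.1.1 s, w.1.2 s, w.2 s)].
rewrite (reindex zip).
  apply: eq_big => [w|w _]; first by rewrite ffunE.
  by rewrite memoryless_lawE; apply: eq_bigr => s _; rewrite ffunE.
exists (fun u : {ffun 'I_n -> T} =>
  ([ffun s => (u s).1.1], [ffun s => (u s).1.2], [ffun s => (u s).2])) => [[[x e] y] _|u _].
  by congr (_, _, _); apply/ffunP => s; rewrite !ffunE.
by apply/ffunP => s; rewrite !ffunE; case: (u s) => [[]].
Qed.

(** The triples are independent across time, so P(y,e) is the product of the P(y_t,e_t) and cancels
    the denominators of [surrogate]. Positive mass at [w] makes this product nonzero. *)
Lemma memoryless_surrogate n (w : blocks Xmax Emax n) :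
  0 < law n w -> surrogate (law n) w = law n w.
Proof.
move=> w0; set L := law n.
have L0 := @blocks_law_ge0 _ _ _ pX pE memoryless n.
pose q := single_letter_law pX pE k.
have n_t t b c : Pr L (fun v => (v.2 t == b) && (v.1.2 t == c)) = \sum_a q (a, c, b).
  rewrite (Pr_total _ (fun v : blocks Xmax Emax n => v.1.1 t)); apply: eq_bigr => a _.
  rewrite /q (memoryless_letter t); apply: eq_Pr => v.
  by rewrite !xpair_eqE andbC [in RHS]andbAC -andbA.
have m_t t : Pr L (fun v => [&& v.1.1 t == w.1.1 t, v.2 t == w.2 t & v.1.2 t == w.1.2 t]) =
    q (w.1.1 t, w.1.2 t, w.2 t).
  by rewrite /q (memoryless_letter t); apply: eq_Pr => v; rewrite !xpair_eqE andbAC -andbA.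
have YE : Pr L (fun v => (v.2 == w.2) && (v.1.2 == w.1.2)) =
    \prod_t \sum_a q (a, w.1.2 t, w.2 t).
  rewrite (Pr_total _ (fun v => v.1.1)).
  rewrite (bigA_distr_bigA (fun t a => q (a, w.1.2 t, w.2 t))); apply: eq_bigr => x _.
  rewrite (@Pr_pred1 _ _ _ _ (x, w.1.2, w.2)) /L ?memoryless_lawE// => v.
  by case: v => [[x' e'] y']; rewrite /= !xpair_eqE andbC [in RHS]andbAC -andbA.
rewrite /surrogate YE; under [X in _ * X]eq_bigr do rewrite m_t n_t.
rewrite prodf_div mulrCA divff ?mulr1 /L ?memoryless_lawE//.
by rewrite -YE gt_eqF// (Pr_gt0 L0 _ w0)// !eqxx.
Qed.

Lemma memoryless_leakage : leakage_rate pX pE memoryless = (single_letter_info pX pE k)%:E.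
Proof.
suff cmiE n : cond_mutual_info (law n) (@Xn Xmax Emax n) (@Yn Xmax Emax n)
    (@En Xmax Emax n) = n%:R * single_letter_info pX pE k.
  apply: (fun cvgl => (cvg_limn_einf_sup cvgl).2).
  (* The normalized information is constant for n >= 1; the shift drops n = 0, where the convention
     0^-1 = 0 gives the value 0. *)
  rewrite -cvg_shiftS; under eq_fun do rewrite cmiE mulKf ?pnatr_eq0//.
  exact: (@cvg_cst (\bar R) (single_letter_info pX pE k)%:E nat \oo eventually_filter).
rewrite cond_mutual_info_blocks_law [X in _ + X]big1 => [|w _]; last first.
  have [w0|w0] := ltrP 0 (law n w).
    by rewrite memoryless_surrogate// divff ?gt_eqF// ln1 mulr0.
  by rewrite (_ : law n w = 0) ?mul0r//; apply/eqP; rewrite eq_le w0 blocks_law_ge0.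
rewrite addr0 (eq_bigr (fun=> single_letter_info pX pE k)) => [|t _].
  by rewrite sumr_const card_ord mulr_natl.
apply/esym.
apply: (@cond_mutual_info_map _ _ (law n) _ _ _ _ (fun w : blocks Xmax Emax n =>
  (w.1.1 t, w.1.2 t, w.2 t))).
exact: memoryless_letter.
Qed.

End Memoryless.

Theorem theorem5 (R : realType) (Xmax Emax : nat)
    (pX : fdist R (load Xmax)) (pE : fdist R (energy Emax)) :
  optimal_leakage pX pE =
    ereal_inf [set (single_letter_info pX pE k)%:E
              | k in [set k : load Xmax -> energy Emax -> fdist R (load Xmax) |
                      kernel_class k]]
  /\
  ereal_inf [set (single_letter_info pX pE k)%:E
            | k in [set k : load Xmax -> energy Emax -> fdist R (load Xmax) |
                    kernel_class k]] =
    (\sum_(e : energy Emax)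
       (pE e)%:E * privacy_power pX (e : nat)%:R (e : nat)%:R)%E.
Proof.
split.
  apply/eqP; rewrite eq_le; apply/andP; split; apply/ereal_infP => _ [k kk <-].
    apply: ereal_inf_lbound; exists (memoryless k).
      exact: memoryless_feasible.
    exact: memoryless_leakage.
  rewrite /leakage_rate limn_esup_lim.
  apply: lime_ge; first exact: is_cvg_esups.
  (* Each tail supremum dominates the term at [N.+1], an index chosen to be positive so that
     dividing by it is harmless. *)
  apply: nearW => N; apply: (le_trans _ (ereal_sup_ubound _)); last first.
    by exists N.+1 => //=; exact: leqnSn.
  set J := ereal_inf _; set n := N.+1.
  have Jt t : (J <= (cond_mutual_info (@blocks_law R Xmax Emax pX pE k n)
      (fun w => w.1.1 t) (fun w => w.2 t) (fun w => w.1.2 t))%:E)%E.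
    have [q qq <-] := exists_letter_kernel t kk.
    by apply: ereal_inf_lbound; exists q.
  (* The value +oo is excluded because [J] lies below a finite letter information; -oo is
     trivial. *)
  case: J Jt => [r| |] Jt.
  - rewrite lee_fin ler_pdivlMl ?ltr0n// mulr_natl.
    apply: le_trans (sum_letter_info_le _ _ _ _).
    have -> : r *+ n = \sum_(t < n) r by rewrite sumr_const card_ord.
    by apply: ler_sum => t _; rewrite -lee_fin.
  - by have := Jt ord0.
  - exact: leNye.
under [RHS]eq_bigr do rewrite privacy_powerE.
rewrite -(ereal_inf_convex_comb pE) => [|q|e]; last 2 first.
- by apply: mutual_info_ge0; [exact: channel_law_ge0|exact: sum_channel_law].
(* Nonemptiness: applied to the zero mass, [exists_conditional] supplies a law with the required
   support for each [x]. *)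
- have /choice[q qP] : forall x : load Xmax, exists p : fdist R (load Xmax),
      (forall y, 0 * p y = 0) /\
      (forall y : load Xmax, ~~ ~~ ((x < y)%N || (y + e < x)%N) -> p y = 0).
    move=> x; apply: (@exists_conditional _ _ _ (fun=> 0) _ x) => //.
      by rewrite big1.
    by rewrite ltnn/= -leqNgt leq_addr.
  by exists q => x y xy; have [_] := qP x; apply; rewrite negbK.
(* A kernel of the class is the same as a free choice, for each energy value, of a channel obeying
   the constraint for that value; only the order of the arguments changes. *)
congr ereal_inf; apply/seteqP; split=> _ [k kk <-].
  exists (fun c x => k x c); last by rewrite single_letter_infoE.
  by move=> c x y; exact: kk.
exists (fun x c => k c x); last by rewrite single_letter_infoE.
by move=> x c y; exact: kk.
Qed.
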